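(* For every positive integer $t$: (1) there exists a Noetherian filtration $\{I_n\}$ of homogeneous ideals in a Noetherian $\mathbb N$-graded domain $R$ such that $\operatorname{Ass}(R/I_n)=\operatorname{Ass}(R/I_{n+1})$ for all $n\gg0$, and there exist two primes $P,Q$ which are maximal (with respect to inclusion) in $\operatorname{Ass}(R/I_n)$ for all $n\gg0$ such that $$\lim_{n\to\infty}\frac{v_Q(I_n)}{n}-\lim_{n\to\infty}\frac{v_P(I_n)}{n}=t;$$ (2) there exists a homogeneous ideal $I_t$ in a Noetherian $\mathbb N$-graded domain and there exist two primes $P,Q$ which are maximal (with respect to inclusion) in $\overline A(I_t)$ such that $$\lim_{n\to\infty}\frac{v_P(I_t^n)}{n}\ne\lim_{n\to\infty}\frac{v_Q(I_t^n)}{n}.$$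
   Context: A filtration $\{I_n\}_{n\in\mathbb N}$ of ideals of a commutative Noetherian ring $R$ is a family with $I_0=R$, $I_rI_s\subset I_{r+s}$ for all $r,s\in\mathbb N$, and $I_s\subset I_r$ whenever $r\le s$. It is Noetherian if $\bigoplus_{n\ge0}I_n$ is a finitely generated $R$-algebra. For a homogeneous ideal $I$ of an $\mathbb N$-graded Noetherian ring $R=\bigoplus_nR_n$ and $\mathfrak p\in\operatorname{Ass}(R/I)$, the local $v$-number is $v_{\mathfrak p}(I)=\min\{u:\text{there exists } f\in R_u\text{ with }\mathfrak p=(I:f)\}$. For an ideal $I$ of a Noetherian ring $R$, $\overline A(I)$ denotes the stable set $\operatorname{Ass}(R/I^n)$ for $n\gg0$ (it is eventually constant by Brodmann's theorem). The limits are asserted to exist. *)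

(* Defs.v *)
From HB Require Import structures.
From mathcomp Require Import all_boot all_order all_algebra.
From mathcomp Require Import all_classical all_reals all_analysis.

Set Implicit Arguments.
Unset Strict Implicit.
Unset Printing Implicit Defensive.

Import Order.TTheory GRing.Theory Num.Theory.
Import numFieldNormedType.Exports.

Local Open Scope classical_set_scope.
Local Open Scope ring_scope.

Section Ideals.
Variable R : comNzRingType.
Implicit Types (I J p : set R) (F : nat -> set R).

(* Ideals, possibly improper, are the submodules of R over itself. *)
Definition ideal I : Prop := GRing.submod_closed [in (I : set R^o)].

Definition prime_ideal p : Prop := idealr_closed [in p] /\ prime_idealr_closed [in p].

Definition ideal_gen (S : set R) : set R := smallest ideal S.

Definition noetherian : Prop :=
  forall I, ideal I -> exists s : seq R, I = ideal_gen [set` s].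

Definition ideal_mul I J : set R :=
  ideal_gen [set z | exists2 x, I x & exists2 y, J y & z = x * y].

Definition ideal_pow I n : set R := iter n (ideal_mul I) setT.

Definition colon I (f : R) : set R := [set r | I (r * f)].

(* Ass(R/I): the annihilator in R of the class of f in R/I is (I : f). *)
Definition Ass I : set (set R) :=
  [set p | prime_ideal p /\ exists f : R, p = colon I f].

Definition maximal_in (A : set (set R)) p : Prop :=
  A p /\ forall q, A q -> p `<=` q -> q = p.

(* A is the eventual value of Ass(R/I^n); there is at most one such A, and
   Brodmann's theorem says that there is one when R is Noetherian. *)
Definition stable_Ass I (A : set (set R)) : Prop :=
  \forall n \near \oo, Ass (ideal_pow I n) = A.

Definition filtration F : Prop :=
  [/\ forall n, ideal (F n),
      F 0%N = setT,
      forall r s, ideal_mul (F r) (F s) `<=` F (r + s)%N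
    & forall r s, (r <= s)%N -> F s `<=` F r].

(* The graded algebra \bigoplus_n F_n, realized as the subalgebra
   \sum_n F_n X^n of R[X]. *)
Definition rees F : set {poly R} := [set g : {poly R} | forall n, F n g`_n].

Definition subalg_gen (S : set {poly R}) : set {poly R} :=
  smallest (fun B : set {poly R} => GRing.subalg_closed [in B]) S.

Definition noetherian_filtration F : Prop :=
  filtration F /\ exists s : seq {poly R}, rees F = subalg_gen [set` s].

(* G n is the degree n component R_n. *)
Definition grading (G : nat -> set R) : Prop :=
  [/\ forall n, GRing.zmod_closed [in G n],
      G 0%N 1,
      forall m n x y, G m x -> G n y -> G (m + n)%N (x * y),
      forall x, exists n (c : nat -> R),
        (forall i, G i (c i)) /\ x = \sum_(i < n) c i
    & forall n (c : nat -> R), (forall i, G i (c i)) ->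
        \sum_(i < n) c i = 0 -> forall i, (i < n)%N -> c i = 0].

Definition homogeneous_ideal (G : nat -> set R) I : Prop :=
  I = ideal_gen [set x | I x /\ exists n, G n x].

Definition vdegrees (G : nat -> set R) p I : set nat :=
  [set u | exists2 f, G u f & p = colon I f].

(* The minimum of vdegrees; the set is nonempty when I is homogeneous and
   p is in Ass I, and the value is a default one when the set is empty. *)
Definition vnumber (G : nat -> set R) p I : nat :=
  get [set u | vdegrees G p I u /\
               forall w, vdegrees G p I w -> (u <= w)%N].

End Ideals.

Definition vslope (K : realType) (R : comNzRingType) (G : nat -> set R)
    (p : set R) (F : nat -> set R) : K ^nat :=
  fun n => (vnumber G p (F n))%:R / n%:R.

Arguments noetherian R : clear implicits.
Arguments vslope K {R} G p F _.

(* Main.v *)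
(* Let R = F[z][x][y] with deg z = deg y = 0 and deg x = t, and let
   I = (y^2, xy, x^2 z). A monomial argument gives
   I^n = (x, y)^(2n) \cap (y, z)^n, an intersection of two primary ideals, so
   that for n > 0 the associated primes of I^n are P = (x, y) and Q = (y, z),
   which are incomparable. Now P = (I^n : y^(2n-1)) is witnessed in degree 0,
   so that v_P(I^n) = 0. If Q = (I^n : f) then f lies in (x, y)^(2n) but not in
   (y, z)^n, so f contains a monomial with fewer than n factors y, hence with
   more than n factors x; with the witness x^(n+1) y^(n-1) this gives
   v_Q(I^n) = t (n + 1). The filtration of powers of I answers both parts. *)

Require Import Defs.
From HB Require Import structures.
From mathcomp Require Import all_boot all_order all_algebra.
From mathcomp Require Import zify ring.
From mathcomp Require Import all_classical all_reals all_analysis.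

Set Implicit Arguments.
Unset Strict Implicit.
Unset Printing Implicit Defensive.

Import Order.TTheory GRing.Theory Num.Theory.
Import numFieldNormedType.Exports.

Local Open Scope classical_set_scope.
Local Open Scope ring_scope.

(** * Auxiliary facts and elementary ideal theory *)

Lemma near_succ (S : nat -> Prop) :
  (forall n, S n.+1) -> \forall n \near \oo, S n.
Proof. by move=> SS; exists 1%N => // -[]. Qed.

Lemma drop_polyMX (A : nzSemiRingType) (p : {poly A}) :
  drop_poly 1 p * 'X + (p`_0)%:P = p.
Proof.
apply/polyP => -[|i]; rewrite coefD coefMX coefC /= ?add0r //.
by rewrite addr0 coef_drop_poly addn1.
Qed.

Section IdealTheory.
Variable R : comNzRingType.
Implicit Types (I J S : set R) (a u v : R).

Lemma idealE I :
  ideal I <-> I 0 /\ forall a u v, I u -> I v -> I (a * u + v).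
Proof.
split=> -[I0 IL]; split.
- by move: I0; rewrite in_setE.
- by move=> a u v Iu Iv; have := IL a u v; rewrite !in_setE; apply.
- by rewrite in_setE.
- by move=> a u v; rewrite !in_setE; exact: IL.
Qed.

Lemma ideal0 I : ideal I -> I 0.
Proof. by move=> /idealE[]. Qed.

Lemma idealD I u v : ideal I -> I u -> I v -> I (u + v).
Proof. by move=> /idealE[_ IL] Iu Iv; rewrite -[u]mul1r; exact: IL. Qed.

Lemma idealM I a u : ideal I -> I u -> I (a * u).
Proof. by move=> /idealE[I0 IL] Iu; rewrite -[_ * _]addr0; exact: IL. Qed.

Lemma idealT I : ideal I -> I 1 -> I = setT.
Proof.
move=> I_ideal I1; apply/seteqP; split=> // x _.
by rewrite -[x]mulr1; exact: idealM.
Qed.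

Lemma ideal_ideal_gen S : ideal (ideal_gen S).
Proof.
apply/idealE; split=> [J [] /ideal0 //|a u v Su Sv J [J_ideal SJ]].
by apply: idealD => //; first apply: idealM => //; [apply: Su|apply: Sv].
Qed.

Lemma ideal_gen_sub S I : ideal I -> S `<=` I -> ideal_gen S `<=` I.
Proof. exact: smallest_sub. Qed.

Lemma sub_ideal_gen S : S `<=` ideal_gen S.
Proof. exact: sub_gen_smallest. Qed.

Lemma ideal_sum I (J : Type) (r : seq J) (P : pred J) (F : J -> R) :
  ideal I -> (forall i, P i -> I (F i)) -> I (\sum_(i <- r | P i) F i).
Proof.
move=> I_ideal IF; elim/big_ind : _ => //; first exact: ideal0.
by move=> ? ?; exact: idealD.
Qed.

Lemma ideal_colon I a : ideal I -> ideal (colon I a).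
Proof.
move=> I_ideal; apply/idealE; split=> [|b u v]; rewrite /colon /=.
  by rewrite mul0r; exact: ideal0.
by rewrite mulrDl -mulrA => ? ?; apply: idealD => //; exact: idealM.
Qed.

End IdealTheory.

(** * Noetherian rings: fields and Hilbert's basis theorem *)

Lemma noetherian_field (F : fieldType) : noetherian F.
Proof.
move=> I I_ideal; have [I1|nI1] := pselect (I 1).
  exists [:: 1]; rewrite (idealT I_ideal I1); apply/esym/idealT.
    exact: ideal_ideal_gen.
  by apply: sub_ideal_gen => /=; rewrite mem_head.
exists [::]; apply/seteqP; split=> x.
  have [-> _|x0 Ix] := eqVneq x 0.
    exact: ideal0 (@ideal_ideal_gen F [set` [::]]).
  by case: nI1; rewrite -(mulVf x0); exact: (@idealM F).
by apply: ideal_gen_sub.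
Qed.

Section Hilbert.
Variable R : comNzRingType.

(** The leading coefficients of members of degree [n], together with 0: the size bound, rather than
    an exact degree, is what makes this an ideal. *)
Definition leading_ideal (I : set {poly R}) n : set R :=
  [set c | exists f, [/\ I f, (size f <= n.+1)%N & f`_n = c]].

Lemma ideal_leading_ideal I n : ideal I -> ideal (leading_ideal I n).
Proof.
move=> I_ideal; apply/idealE; split.
  by exists 0; rewrite size_poly0 coef0; split => //; exact: ideal0.
move=> a _ _ [f [If sf <-]] [g [Ig sg <-]]; exists (a%:P * f + g).
rewrite coefD coefCM; split=> //; first by apply: idealD => //; exact: idealM.
rewrite (leq_trans (size_polyD _ _)) // geq_max sg mul_polyC.
by rewrite (leq_trans (size_scale_leq _ _)).
Qed.

(** Multiplication by ['X^(n - m)] shifts the leading term without leaving [I]. *)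
Lemma leading_ideal_leq I m n : ideal I -> (m <= n)%N ->
  leading_ideal I m `<=` leading_ideal I n.
Proof.
move=> I_ideal mn _ [f [If sf <-]]; exists ('X^(n - m) * f).
rewrite coefXnM ltnNge leq_subr /= subKn //; split=> //; first exact: idealM.
rewrite (leq_trans (size_polyMleq _ _)) // size_polyXn /=.
by rewrite (leq_trans (leq_add (leqnn _) sf)) // addnS subnK.
Qed.

Lemma ascending_bound (T : eqType) (L : nat -> set T) (s : seq T) :
  (forall m n, (m <= n)%N -> L m `<=` L n) ->
  {in s, forall c, exists n, L n c} -> exists N, {in s, forall c, L N c}.
Proof.
move=> L_le; elim: s => [|c s IHs] cs; first by exists 0%N.
have [|N LN] := IHs; first by move=> d ds; apply: cs; rewrite inE ds orbT.
have [n Ln] := cs c (mem_head _ _); exists (maxn n N) => d.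
rewrite inE => /orP[/eqP->|/LN].
  exact: L_le (leq_maxl _ _) _ Ln.
exact: L_le (leq_maxr _ _) _.
Qed.

(** The ideals of leading coefficients stabilize at some [N]. Polynomials lifting finite generating
    sets of those of index at most [N] generate [I], because they suffice to cancel any leading
    term. *)
Lemma noetherian_poly : noetherian R -> noetherian {poly R}.
Proof.
move=> noethR I I_ideal.
pose L := leading_ideal I.
have L_le m n : (m <= n)%N -> L m `<=` L n by exact: leading_ideal_leq.
have [|s sE] := noethR (\bigcup_n L n).
  apply/idealE; split; first exists 0%N => //.
    exact: ideal0 (ideal_leading_ideal _ I_ideal).
  move=> a u v [m _ Lu] [n _ Lv]; exists (maxn m n) => //.
  have Li := ideal_leading_ideal (maxn m n) I_ideal.
  apply: idealD => //; first apply: idealM => //.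
    exact: L_le (leq_maxl _ _) _ Lu.
  exact: L_le (leq_maxr _ _) _ Lv.
(* The union of the chain is finitely generated, so one stage [N] already contains its
   generators. *)
have [|N sN] := @ascending_bound _ L s L_le.
  move=> c cs; have : (\bigcup_n L n) c by rewrite sE; exact: sub_ideal_gen.
  by case=> n _ Lc; exists n.
have L_top n : L n `<=` L N.
  apply: (@subset_trans _ (\bigcup_n L n)); first exact: bigcup_sup.
  rewrite sE; apply: ideal_gen_sub; [exact: ideal_leading_ideal|exact: sN].
have /choice[T T_gen] m : exists g : seq {poly R},
    (forall f, f \in g -> I f /\ (size f <= m.+1)%N) /\
    L m = ideal_gen [set` [seq f`_m | f : {poly R} <- g]].
  have [r rE] := noethR (L m) (ideal_leading_ideal m I_ideal).
  (* The lift [h] has to be total; outside [L m] it takes the default value 0. *)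
  have /choice[h hP] c : exists f, L m c ->
      [/\ I f, (size f <= m.+1)%N & f`_m = c].
    by have [[f fP]|nLc] := pselect (L m c); [exists f|exists 0].
  have rL c (cr : c \in r) : L m c by rewrite rE; exact: sub_ideal_gen.
  exists (map h r); split.
    by move=> _ /mapP[c /rL Lc ->]; have [] := hP c Lc.
  rewrite -map_comp map_id_in // => c /rL Lc.
  by have [] := hP c Lc.
have [r mem_r] : exists r : seq nat, forall m : nat, (m \in r) = (m <= N)%N.
  by exists (iota 0 N.+1) => m; rewrite mem_iota.
pose G := ideal_gen [set` flatten [seq T m | m <- r]].
have G_ideal : ideal G := @ideal_ideal_gen _ _.
have lift m c : (m <= N)%N -> L m c ->
    exists g, [/\ G g, (size g <= m.+1)%N & g`_m = c].
  move=> mN; have [TI ->] := T_gen m; move: c.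
  apply: (@ideal_gen_sub _ _ (leading_ideal G m)).
    exact: ideal_leading_ideal.
  move=> _ /= /mapP[f fT ->]; exists f; split=> //; last by have [] := TI f fT.
  by apply: sub_ideal_gen => /=; apply/flatten_mapP; exists m; rewrite ?mem_r.
have GI : G `<=` I.
  apply: ideal_gen_sub => // g /= /flatten_mapP[k _ gT].
  by have [/(_ _ gT)[]] := T_gen k.
exists (flatten [seq T m | m <- r]); apply/seteqP; split=> //.
(* Induction on a bound for the size, each step removing the top coefficient. *)
suff all_size n f : I f -> (size f <= n)%N -> G f.
  by move=> f If; exact: all_size (leqnn _).
elim: n f => [|n IHn] f If sf.
  by move: sf; rewrite leqn0 size_poly_eq0 => /eqP->; exact: ideal0.
(* Beyond degree [N] the coefficient is lifted in degree [N], and the lift is then shifted up to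
   degree [n]. *)
have Lfn : L (minn n N) f`_n.
  by case: leqP => [_|_]; [exists f|apply: (L_top n); exists f].
have [g [Gg sg gE]] := lift _ _ (geq_minr n N) Lfn.
pose h := 'X^(n - minn n N) * g.
have Gh : G h by exact: idealM G_ideal Gg.
rewrite -(subrK h f); apply: (idealD G_ideal) => //; apply: IHn.
  apply: (idealD I_ideal) => //; rewrite -mulN1r.
  exact: idealM I_ideal (GI _ Gh).
have sh : (size h <= n.+1)%N.
  rewrite (leq_trans (size_polyMleq _ _)) // size_polyXn /=.
  by rewrite (leq_trans (leq_add (leqnn _) sg)) // addnS subnK // geq_minl.
apply/leq_sizeP => i; rewrite leq_eqVlt => /orP[/eqP<-|ni].
  by rewrite coefB coefXnM ltnNge leq_subr /= subKn ?geq_minl// gE subrr.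
by rewrite coefB !nth_default ?subrr // (leq_trans _ ni).
Qed.

End Hilbert.

(** * Prime ideals and the minimum defining the v-number *)

Lemma prime_idealE (R : comNzRingType) (p : set R) : prime_ideal p ->
  ~ p 1 /\ forall u v, p (u * v) -> p u \/ p v.
Proof.
move=> [[_ /negP p1 _] pM]; split; first by move: p1; rewrite in_setE.
by move=> u v; have := pM u v; rewrite !in_setE => + uv => /(_ uv)/orP[];
  rewrite in_setE; [left|right].
Qed.

Lemma prime_ideal_exp (R : comNzRingType) (p : set R) u n : prime_ideal p ->
  p (u ^+ n) -> p u.
Proof.
move=> /prime_idealE[p1 pM]; elim: n => [|n IHn]; first by rewrite expr0.
by rewrite exprS => /pM[].
Qed.

Lemma vnumberE (R : comNzRingType) (G : nat -> set R) p I m :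
  vdegrees G p I m -> (forall w, vdegrees G p I w -> (m <= w)%N) ->
  vnumber G p I = m.
Proof.
move=> mG mw; apply: get_unique => // w [wG ww].
by apply/eqP; rewrite eqn_leq ww ?mw.
Qed.

(** * Powers of an ideal: filtration, Rees algebra, homogeneity *)

Section IdealPowers.
Variable R : comNzRingType.
Implicit Types (I J K S : set R) (G : nat -> set R).

Lemma mem_ideal_mul I J u v : I u -> J v -> ideal_mul I J (u * v).
Proof. by move=> Iu Jv; apply: sub_ideal_gen; exists u => //; exists v. Qed.

Lemma ideal_mul_sub I J K : ideal K ->
  (forall u v, I u -> J v -> K (u * v)) -> ideal_mul I J `<=` K.
Proof.
by move=> K_ideal IJK; apply: ideal_gen_sub => // _ [u Iu [v Jv ->]]; exact: IJK.
Qed.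

(** The colon [K : v] is an ideal, so it contains the ideal generated by [S] as soon as it contains
    [S]. *)
Lemma ideal_gen_mul S K v : ideal K ->
  (forall u, S u -> K (u * v)) -> forall u, ideal_gen S u -> K (u * v).
Proof.
by move=> K_ideal SK; apply: (@ideal_gen_sub _ _ (colon K v)) => //; exact: ideal_colon.
Qed.

Lemma ideal_ideal_pow I n : ideal (ideal_pow I n).
Proof. by case: n => [|n]; [exact/idealE|exact: ideal_ideal_gen]. Qed.

Lemma ideal_pow_mul I m n u v : ideal_pow I m u -> ideal_pow I n v ->
  ideal_pow I (m + n) (u * v).
Proof.
move=> + Iv; elim: m u => [|m IHm] u.
  by move=> _; exact: idealM (ideal_ideal_pow _ _) Iv.
apply: ideal_gen_mul; first exact: ideal_ideal_pow.
by move=> _ [a Ia [b Ib ->]]; rewrite -mulrA; apply: mem_ideal_mul => //; exact: IHm.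
Qed.

Lemma ideal_pow_leq I m n : (m <= n)%N -> ideal_pow I n `<=` ideal_pow I m.
Proof.
move=> /subnK <- u; elim: (n - m)%N => // k IHk.
move=> uI; apply: IHk; apply: (ideal_mul_sub _ _ uI); first exact: ideal_ideal_pow.
by move=> a b _; exact: idealM (ideal_ideal_pow _ _).
Qed.

Lemma filtration_ideal_pow I : filtration (ideal_pow I).
Proof.
split=> [n|//|r s|r s]; first exact: ideal_ideal_pow.
  apply: ideal_mul_sub; first exact: ideal_ideal_pow.
  by move=> u v; exact: ideal_pow_mul.
exact: ideal_pow_leq.
Qed.

Lemma subalg_closedE (B : set {poly R}) : GRing.subalg_closed [in B] <->
  [/\ B 1, forall a u v, B u -> B v -> B (a *: u + v)
         & forall u v, B u -> B v -> B (u * v)].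
Proof.
split=> -[B1 BL BM]; split.
- by move: B1; rewrite in_setE.
- by move=> a u v Bu Bv; have := BL a u v; rewrite !in_setE; apply.
- by move=> u v Bu Bv; have := BM u v; rewrite !in_setE; apply.
- by rewrite in_setE.
- by move=> a u v; rewrite !in_setE; exact: BL.
- by move=> u v; rewrite !in_setE; exact: BM.
Qed.

(** The Rees algebra of a finitely generated ideal is generated in degree one, hence the powers form
    a Noetherian filtration. *)
Lemma rees_ideal_pow (s : seq R) : let I := ideal_gen [set` s] in
  rees (ideal_pow I) = subalg_gen [set` [seq a%:P * 'X | a <- s]].
Proof.
move=> I; have I_ideal n : ideal (ideal_pow I n) by exact: ideal_ideal_pow.
apply/seteqP; split=> [g Ig B [/subalg_closedE[B1 BL BM] sB]|]; last first.
  apply: smallest_sub; first (apply/subalg_closedE; split).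
  - move=> n; rewrite coef1; case: eqP => [->//|_]; exact: ideal0.
  - move=> a u v Iu Iv n; rewrite coefD coefZ.
    by apply: idealD => //; apply: idealM.
  - move=> u v Iu Iv n; rewrite coefM; apply: ideal_sum => // i _.
    have := ideal_pow_mul (Iu i) (Iv (n - i)%N).
    by rewrite subnKC // -ltnS.
  move=> _ /mapP[a sa ->] n; rewrite coefMX coefC.
  case: n => [|[|n]] /=; [by []| |exact: ideal0 (I_ideal n.+2)].
  by rewrite -[a]mulr1; apply: mem_ideal_mul => //; exact: sub_ideal_gen.
have B0 : B 0 by have := BL (-1) _ _ B1 B1; rewrite scaleN1r addNr.
(* Since these coefficients form an ideal, membership of a power of [I] need only be tested on
   products with a generator in front. *)
have BI n : ideal [set c : R | B (c *: 'X^n)].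
  apply/idealE; split=> [|a u v] /=; first by rewrite scale0r.
  by rewrite scalerDl -scalerA; exact: BL.
have BX n c : ideal_pow I n c -> B (c *: 'X^n).
  elim: n c => [|n IHn] c.
    by move=> _; rewrite expr0 -[_ *: _]addr0; exact: BL.
  move: c; apply: (ideal_mul_sub (BI n.+1)) => u v + Iv; move: u.
  apply: (ideal_gen_mul (BI n.+1)) => a sa /=.
  rewrite -mul_polyC polyCM exprS mulrACA (mul_polyC v).
  by apply: BM; [apply: sB; apply/mapP; exists a|exact: IHn].
rewrite -[g]coefK poly_def; elim/big_ind : _ => //.
  by move=> u v Bu Bv; rewrite -[u]scale1r; exact: BL.
by move=> i _; exact: BX.
Qed.

Lemma homogeneous_setT G : grading G -> homogeneous_ideal G setT.
Proof.
move=> [_ G1 _ _ _]; apply/esym/idealT; first exact: ideal_ideal_gen.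
by apply: sub_ideal_gen; split=> //; exists 0%N.
Qed.

Lemma homogeneous_ideal_gen G S :
  (forall u, S u -> exists n, G n u) -> homogeneous_ideal G (ideal_gen S).
Proof.
move=> SG; apply/seteqP; split; apply: ideal_gen_sub; try exact: ideal_ideal_gen.
  move=> u Su; apply: sub_ideal_gen; split; [exact: sub_ideal_gen|exact: SG].
by move=> u [].
Qed.

(** Each factor in turn is reduced to homogeneous elements, commutativity bringing the second one to
    the front; products of homogeneous elements are homogeneous. *)
Lemma homogeneous_ideal_mul G I J : grading G -> homogeneous_ideal G I ->
  homogeneous_ideal G J -> homogeneous_ideal G (ideal_mul I J).
Proof.
move=> [_ _ GM _ _] I_hom J_hom; apply/seteqP; split; last first.
  by apply: ideal_gen_sub; [exact: ideal_ideal_gen|move=> u []].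
set K := ideal_gen _; have K_ideal : ideal K by exact: ideal_ideal_gen.
apply: ideal_mul_sub => // u v + Jv; rewrite I_hom; move: u.
apply: ideal_gen_mul => // u [Iu [m Gu]]; move: Jv; rewrite mulrC J_hom.
apply: ideal_gen_mul => // w [Jw [n Gw]]; rewrite mulrC.
apply: sub_ideal_gen; split; first exact: mem_ideal_mul.
by exists (m + n)%N; exact: GM.
Qed.

Lemma homogeneous_ideal_pow G I n : grading G -> homogeneous_ideal G I ->
  homogeneous_ideal G (ideal_pow I n).
Proof.
move=> G_grading I_hom; elim: n => [|n IHn]; first exact: homogeneous_setT.
exact: homogeneous_ideal_mul.
Qed.

End IdealPowers.

(** * Prime elements of a domain and divisibility by their powers *)

Section PrimeElement.
Variable C : idomainType.
Implicit Types (p a b : C).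

Definition divides p a := exists q, a = q * p.

Definition prime_element p :=
  [/\ p != 0, ~ divides p 1
    & forall a b, divides p (a * b) -> divides p a \/ divides p b].

Lemma divides0 p : divides p 0.
Proof. by exists 0; rewrite mul0r. Qed.

Lemma dividesD p a b : divides p a -> divides p b -> divides p (a + b).
Proof. by move=> [q ->] [r ->]; exists (q + r); rewrite mulrDl. Qed.

Lemma divides_mull p a b : divides p b -> divides p (a * b).
Proof. by move=> [q ->]; exists (a * q); rewrite mulrA. Qed.

Lemma divides_mulr p a b : divides p a -> divides p (a * b).
Proof. by rewrite mulrC; exact: divides_mull. Qed.

Lemma divides_sum p (J : Type) (r : seq J) (P : pred J) (F : J -> C) :
  (forall i, P i -> divides p (F i)) -> divides p (\sum_(i <- r | P i) F i).
Proof.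
by move=> pF; elim/big_ind : _ => //; [exact: divides0|exact: dividesD].
Qed.

Lemma divides_addl p a b : divides p a -> divides p (a + b) -> divides p b.
Proof. by move=> [q ->] [r rE]; exists (r - q); rewrite mulrBl -rE addrC addKr. Qed.

Lemma divides_exp p m n a :
  (m <= n)%N -> divides (p ^+ n) a -> divides (p ^+ m) a.
Proof.
by move=> mn [q ->]; exists (q * p ^+ (n - m)); rewrite -mulrA -exprD subnK.
Qed.

Lemma divides_prime_exp p n a :
  prime_element p -> divides p (a ^+ n) -> divides p a.
Proof.
move=> [_ p1 pM]; elim: n => [|n IHn]; first by rewrite expr0 => /p1.
by rewrite exprS => /pM[].
Qed.

(** By induction [a = b * p ^+ n]; cancelling [p ^+ n] leaves [p] dividing [b * q], hence [b]. *)
Lemma divides_exp_prime p q n a : prime_element p -> ~ divides p q ->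
  divides (p ^+ n) (a * q) -> divides (p ^+ n) a.
Proof.
move=> [p0 _ pM] pq; elim: n a => [|n IHn] a; first by exists a; rewrite mulr1.
move=> pn; have [|b abE] := IHn a; first exact: divides_exp pn.
have [c] := pn; rewrite {1}abE exprS mulrA mulrAC => /(mulIf (expf_neq0 n p0)).
move=> bq; have [||//] := pM b q; first by exists c.
by move=> [d dE]; exists d; rewrite abE dE mulrA.
Qed.

End PrimeElement.

(** A nonzero generator of the kernel of a morphism to a domain is prime. It is applied to the
    evaluations at 0 of either variable. *)
Lemma prime_element_ker (C D : idomainType) (phi : {rmorphism C -> D}) (p : C) :
  p != 0 -> (forall a, divides p a <-> phi a = 0) -> prime_element p.
Proof.
move=> p0 pE; split=> // [/pE/eqP|a b /pE/eqP].
  by rewrite rmorph1 oner_eq0.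
by rewrite rmorphM mulf_eq0 => /orP[]/eqP/pE; [left|right].
Qed.

Lemma divides_polyX (C : idomainType) (a : {poly C}) :
  divides 'X a <-> a.[0] = 0.
Proof.
split=> [[q ->]|/eqP/factor_theorem[q ->]]; first by rewrite hornerM hornerX mulr0.
by exists q; rewrite subr0.
Qed.

Lemma prime_polyX (C : idomainType) : prime_element ('X : {poly C}).
Proof.
apply: (@prime_element_ker _ _ (horner_eval (0 : C))); first by rewrite polyX_eq0.
exact: divides_polyX.
Qed.

Lemma divides_polyC (C : idomainType) (p : C) (a : {poly C}) :
  divides p%:P a <-> forall i, divides p a`_i.
Proof.
split=> [[q ->] i|/choice[q qE]]; first by exists q`_i; rewrite coefMC.
exists (\poly_(i < size a) q i); apply/polyP => i; rewrite coefMC coef_poly.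
by case: ltnP => [_|/(nth_default 0) ->]; [exact: qE|rewrite mul0r].
Qed.

Lemma prime_polyCX (C : idomainType) :
  prime_element (('X : {poly C})%:P : {poly {poly C}}).
Proof.
apply: (@prime_element_ker _ _ (map_poly (horner_eval (0 : C)))).
  by rewrite polyC_eq0 polyX_eq0.
move=> a; rewrite divides_polyC; split=> [aX|aE i].
  by apply/polyP => i; rewrite coef_map coef0; exact/divides_polyX.
by apply/divides_polyX; have := coef_map (horner_eval (0 : C)) a i; rewrite aE coef0.
Qed.

(** * Powers of the ideal ('X, p): products, primality, primary property *)

Section WeightIdeal.
Variables (C : idomainType) (p : C).
Implicit Types (f g : {poly C}) (n : nat).

(* The n-th power of the ideal ('X, p). *)
Definition weight_ideal n : set {poly C} :=
  [set f | forall b, divides (p ^+ (n - b)) f`_b].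

Lemma ideal_weight_ideal n : ideal (weight_ideal n).
Proof.
apply/idealE; split=> [b|g f h fW hW b]; first by rewrite coef0; exact: divides0.
rewrite coefD; apply: dividesD (hW b); rewrite coefM.
apply: divides_sum => i _; apply: divides_mull; apply: divides_exp (fW _).
by rewrite leq_sub2l // leq_subr.
Qed.

Lemma weight_ideal_leq m n : (m <= n)%N -> weight_ideal n `<=` weight_ideal m.
Proof.
by move=> mn f fW b; apply: divides_exp (fW b); rewrite leq_sub2r.
Qed.

Lemma weight_ideal1E f : weight_ideal 1 f <-> divides p f`_0.
Proof.
split=> [/(_ 0%N)//|pf [//|b]]; exists f`_b.+1.
by rewrite subSS sub0n mulr1.
Qed.

Lemma weight_ideal_mul m n f g :
  weight_ideal m f -> weight_ideal n g -> weight_ideal (m + n) (f * g).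
Proof.
move=> fW gW b; rewrite coefM; apply: divides_sum => i _.
have ib : (i <= b)%N by rewrite -ltnS.
have [q ->] := fW i; have [r ->] := gW (b - i)%N.
rewrite mulrACA -exprD; apply: divides_mull.
(* With truncated subtraction, (m - i) + (n - (b - i)) is at least m + n - b; the witness is the
   excess power. *)
exists (p ^+ (m - i + (n - (b - i)) - (m + n - b))).
rewrite -exprD subnK // -{1}(subnKC ib) subnDA; lia.
Qed.

Lemma weight_ideal_exp n f : weight_ideal 1 f -> weight_ideal n (f ^+ n).
Proof.
move=> fW; elim: n => [|n IHn]; first by move=> b; exists (f ^+ 0)`_b; rewrite mulr1.
by rewrite exprS -add1n; exact: weight_ideal_mul.
Qed.

Lemma weight_ideal_X : weight_ideal 1 'X.
Proof. by apply/weight_ideal1E; rewrite coefX; exact: divides0. Qed.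

Lemma weight_ideal_C : weight_ideal 1 p%:P.
Proof. by apply/weight_ideal1E; rewrite coefC; exists 1; rewrite mul1r. Qed.

Hypothesis p_prime : prime_element p.

(** Membership only concerns the constant coefficient, which is multiplicative, so primality of [p]
    carries over. *)
Lemma prime_weight_ideal : prime_ideal (weight_ideal 1).
Proof.
have [_ p1 pM] := p_prime.
have W := ideal_weight_ideal 1; split; first split.
- by rewrite in_setE; exact: ideal0.
- by apply/negP; rewrite in_setE weight_ideal1E coefC.
- by move=> a u v; rewrite !in_setE => ? ?; apply: (idealD W) => //; exact: (idealM _ W).
- move=> u v; rewrite in_setE weight_ideal1E coef0M => /pM[] pd; apply/orP; [left|right];
  by rewrite in_setE weight_ideal1E.
Qed.

(* Since p^(n-i) divides f_i, the coefficients (f * g)_b and f_b * g_0 agree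
   modulo p^(n+1-b). *)
Lemma weight_ideal_primary n f g : ~ weight_ideal 1 g ->
  weight_ideal n (f * g) -> weight_ideal n f.
Proof.
rewrite weight_ideal1E => g0; elim: n => [|n IHn] fgW.
  by move=> b; exists f`_b; rewrite mulr1.
have fW := IHn (weight_ideal_leq (leqnSn n) fgW).
move=> b; apply: (divides_exp_prime p_prime g0).
have := fgW b; rewrite coefM big_ord_recr /= subnn; apply: divides_addl.
apply: divides_sum => i _; apply: divides_mulr; apply: divides_exp (fW i).
by have := ltn_ord i; lia.
Qed.

End WeightIdeal.

(** * The grading by the degree in the inner variable *)

Section Grading.
Variables (A : idomainType) (t : nat).
Implicit Types f g : {poly {poly A}}.

(* The inner variable has degree t, the outer variable and A have degree 0. *)
Definition xdegree n : set {poly {poly A}} :=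
  [set f : {poly {poly A}} | forall b a, f`_b`_a != 0 -> (t * a)%N = n].

Definition xcomponent n f : {poly {poly A}} :=
  \poly_(b < size f) \poly_(a < size f`_b) (f`_b`_a *+ (t * a == n)%N).

Lemma coef_xcomponent n f b a :
  (xcomponent n f)`_b`_a = f`_b`_a *+ (t * a == n)%N.
Proof.
rewrite coef_poly; case: ltnP => [_|/(nth_default 0) ->]; last first.
  by rewrite coef0 mul0rn.
rewrite coef_poly; case: ltnP => // /(nth_default 0) ->.
by rewrite mul0rn.
Qed.

Lemma xdegreeP n f :
  xdegree n f <-> forall b a, (t * a)%N <> n -> f`_b`_a = 0.
Proof.
split=> fn b a; last by apply: contra_neqP => /fn.
by move=> ta; apply/eqP; apply: contra_notT ta => /fn.
Qed.

Lemma grading_xdegree : grading xdegree.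
Proof.
split=> [n|b a|m n f g /xdegreeP fm /xdegreeP gn|f|n c cG c0 i ltin].
- split; first by rewrite in_setE => b a; rewrite !coef0 eqxx.
  move=> f g; rewrite !in_setE !xdegreeP => fn gn b a ta.
  by rewrite !coefB fn ?gn ?subrr.
- rewrite coef1; have [_|_] := eqVneq b 0%N; last by rewrite coef0 eqxx.
  by rewrite coef1; case: a => [|a]; rewrite ?muln0 // eqxx.
- apply/xdegreeP => b a ta; rewrite coefM coef_sum big1 // => i _.
  rewrite coefM big1 // => j _.
  have [tj|/eqP/fm->] := eqVneq (t * j)%N m; last by rewrite mul0r.
  rewrite (gn _ (a - j)%N) ?mulr0 // => taj; apply: ta.
  by rewrite -tj -taj -mulnDr subnKC // -ltnS.
(* [N] bounds the inner exponents [a] that occur, so components of degree at most [t * N] recover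
   [f], even when [t] is 0. *)
- pose N := (\max_(b < size f) size (f`_b)%R)%N.
  exists (t * N).+1, (xcomponent ^~ f); split.
    move=> i; apply/xdegreeP => b a /eqP/negPf ta.
    by rewrite coef_xcomponent ta.
  apply/polyP => b; apply/polyP => a; rewrite !coef_sum.
  under eq_bigr do rewrite coef_xcomponent.
  have [fba|fba] := eqVneq f`_b`_a 0.
    by rewrite fba big1 // => i _; rewrite mul0rn.
  have ta : (t * a < (t * N).+1)%N.
    rewrite ltnS leq_mul2l; apply/orP; right.
    have bf : (b < size f)%N.
      by rewrite ltnNge; apply: contra fba => /(nth_default 0) ->; rewrite coef0.
    have af : (a < size (f`_b)%R)%N.
      by rewrite ltnNge; apply: contra fba => /(nth_default 0) ->.
    apply: leq_trans (ltnW af) _.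
    exact: (leq_bigmax (Ordinal bf)).
  rewrite (bigD1 (Ordinal ta)) //= eqxx mulr1n big1 ?addr0 // => i.
  by rewrite -val_eqE /= eq_sym => /negPf ->.
(* A monomial with [t * a = i] can occur in [c i] only, so its coefficient there is its coefficient
   in the sum. *)
- apply/polyP => b; apply/polyP => a; rewrite !coef0.
  have [ta|/eqP ta] := eqVneq (t * a)%N i; last by move/xdegreeP : (cG i) => ->.
  have : (\sum_(i < n) c i)`_b`_a = 0 by rewrite c0 !coef0.
  rewrite !coef_sum (bigD1 (Ordinal ltin)) //= big1 ?addr0 // => j.
  rewrite -val_eqE /= => ji; move/xdegreeP : (cG j) => -> // taj.
  by rewrite -taj ta eqxx in ji.
Qed.

End Grading.

(** * The ideal (y^2, xy, x^2 z) and the decomposition of its powers *)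

Section Example.
Variable F : fieldType.
Local Notation C := {poly {poly F}}.
Local Notation x := ('X : C).
Local Notation z := (('X : {poly F})%:P : C).
Local Notation y := ('X : {poly C}).
Implicit Types (f g : {poly C}) (n : nat).

Definition example_gens : seq {poly C} := [:: y ^+ 2; x%:P * y; (x ^+ 2 * z)%:P].

Definition example_ideal : set {poly C} := ideal_gen [set` example_gens].

(** The intersection of (x, y)^(2n) and (y, z)^n, in a form where membership is read off the
    coefficients in [y]. *)
Definition example_pow n : set {poly C} :=
  weight_ideal x (2 * n) `&` weight_ideal z n.

Let x_prime : prime_element x := prime_polyX {poly F}.
Let z_prime : prime_element z := prime_polyCX F.

Lemma not_divides_xz : ~ divides x z.
Proof. by move/divides_polyX; rewrite hornerC => /eqP; rewrite polyX_eq0. Qed.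

Lemma not_divides_zx : ~ divides z x.
Proof.
move/divides_polyC => /(_ 1%N); rewrite coefX /= => z1.
by have [_ + _] := prime_polyX F; exact.
Qed.

Lemma ideal_example_pow n : ideal (example_pow n).
Proof.
apply/idealE; split.
  by split; exact: ideal0 (ideal_weight_ideal _ _).
move=> a u v [ux uz] [vx vz].
have W p k := @ideal_weight_ideal C p k.
by split; [apply: (idealD (W x (2 * n)%N))|apply: (idealD (W z n))] => //;
  [exact: (idealM _ (W x (2 * n)%N))|exact: (idealM _ (W z n))].
Qed.

(** For a constant in [y], both conditions are divisibilities, by x^(2n) and z^n; since the prime
    [z] does not divide [x], they combine. *)
Lemma weight_ideal_coprime n (g : C) :
  weight_ideal x (2 * n) g%:P -> weight_ideal z n g%:P ->
  exists a, g = a * z ^+ n * x ^+ (2 * n).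
Proof.
move=> /(_ 0%N) + /(_ 0%N); rewrite coefC /= !subn0 => -[a ->].
case/(divides_exp_prime z_prime) => [|b ->]; last by exists b.
by move/(divides_prime_exp z_prime)/not_divides_zx.
Qed.

Lemma divides_x_drop k (a : C) :
  divides (x ^+ k.+1) a -> a`_0 = 0 /\ divides (x ^+ k) (drop_poly 1 a).
Proof.
move=> [q ->]; split; first by rewrite coefMXn.
by exists q; rewrite -(addn1 k) exprD mulrA drop_polyMXn_id.
Qed.

Lemma divides_zP k (a : C) :
  divides (z ^+ k) a <-> forall i, divides ('X ^+ k) a`_i.
Proof. by rewrite -rmorphXn; exact: divides_polyC. Qed.

(* A monomial y^b x^a w with a, b > 0 is divided by x y, one with b = 0 by
   x^2 z, and one with a = 0 by y^2. *)
Lemma example_pow_step n f : example_pow n.+1 f ->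
  exists h q s, [/\ example_pow n h, example_pow n q, example_pow n s
    & f = h * (x ^+ 2 * z)%:P + q * (x%:P * y) + s * y ^+ 2].
Proof.
move=> [fx fz].
(* [q] collects the terms divisible by [x * y], and [s] the terms free of [x] and divisible by y^2;
   what remains of [f] is its constant coefficient in [y]. *)
pose q : {poly C} := \poly_(b < size f) drop_poly 1 f`_b.+1.
pose s : {poly C} := \poly_(b < size f) (f`_b.+2`_0)%:P.
have qE b : q`_b = drop_poly 1 f`_b.+1.
  rewrite coef_poly; case: ltnP => // fb.
  by rewrite (nth_default _ (leqW fb)) drop_poly0r.
have sE b : s`_b = (f`_b.+2`_0)%:P.
  rewrite coef_poly; case: ltnP => // fb.
  by rewrite (nth_default _ (leqW (leqW fb))) coef0 polyC0.
have f0 b : (b <= 2 * n.+1)%N -> divides (x ^+ (2 * n.+1 - b)) f`_b by [].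
(* Here a positive power of [x] divides the coefficient of y^(b+2), which thus has no term free of
   [x]. *)
have s0 b : (b < 2 * n)%N -> s`_b = 0.
  move=> bn; have := fx b.+2; rewrite (_ : _ - _ = (2 * n - b.+1).+1)%N; last by lia.
  by rewrite sE => /divides_x_drop[-> _]; rewrite polyC0.
have qx b : divides (x ^+ (2 * n - b)) q`_b.
  have [bn|nb] := leqP (2 * n) b.
    by rewrite (eqP (bn : (2 * n - b == 0)%N)); exists q`_b; rewrite mulr1.
  have := fx b.+1; rewrite (_ : _ - _ = (2 * n - b).+1)%N; last by lia.
  by rewrite qE => /divides_x_drop[].
have qz b : divides (z ^+ (n - b)) q`_b.
  apply/divides_zP => i; rewrite qE coef_drop_poly.
  by have := fz b.+1; rewrite subSS => /divides_zP.
have sx b : divides (x ^+ (2 * n - b)) s`_b.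
  have [bn|/s0->] := leqP (2 * n) b; last exact: divides0.
  by rewrite (eqP (bn : (2 * n - b == 0)%N)); exists s`_b; rewrite mulr1.
have sz b : divides (z ^+ (n - b)) s`_b.
  have [bn|/s0->] := leqP (2 * n) b; last exact: divides0.
  rewrite (_ : n - b = 0)%N; last by lia.
  by exists s`_b; rewrite mulr1.
have [||a aE] := @weight_ideal_coprime n.+1 f`_0.
  - by case=> [|b]; rewrite coefC /=; [exact: fx|exact: divides0].
  - by case=> [|b]; rewrite coefC /=; [exact: fz|exact: divides0].
exists (a * z ^+ n * x ^+ (2 * n))%:P, q, s; split=> //.
  split=> -[|b]; rewrite coefC /= ?subn0; try exact: divides0.
    by apply: divides_mull; exists 1; rewrite mul1r.
  by apply: divides_mulr; apply: divides_mull; exists 1; rewrite mul1r.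
apply/polyP => -[|[|b]]; rewrite !coefD mulrA coefMX coefMXn -polyCM coefC /=.
- by rewrite !addr0 aE mulnS exprD exprS; ring.
(* The coefficient of [y] is divisible by [x], so [q] accounts for all of it. *)
- have := fx 1%N; rewrite (_ : _ - _ = (2 * n).+1)%N; last by lia.
  move=> /divides_x_drop[f10 _]; rewrite coefMC qE add0r addr0.
  by rewrite -[LHS]drop_polyMX f10 polyC0 addr0.
- rewrite coefMC qE subSS subSS subn0 sE add0r.
  by rewrite drop_polyMX.
Qed.

Lemma example_ideal_sub : example_ideal `<=` example_pow 1.
Proof.
apply: ideal_gen_sub; first exact: ideal_example_pow.
have yW p := @weight_ideal_X C p.
move=> u /=; rewrite !inE => /or3P[] /eqP ->; split; rewrite ?muln1.
- exact: (weight_ideal_exp 2 (yW x)).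
- by rewrite expr2; apply: idealM (yW z); exact: ideal_weight_ideal.
- exact: (weight_ideal_mul (weight_ideal_C x) (yW x)).
- by apply: idealM (yW z); exact: ideal_weight_ideal.
- rewrite mulrC polyCM rmorphXn.
  apply: idealM (weight_ideal_exp 2 (weight_ideal_C x)); exact: ideal_weight_ideal.
- by rewrite polyCM; apply: idealM (weight_ideal_C z); exact: ideal_weight_ideal.
Qed.

(** One inclusion multiplies weights; the other peels off one generator at a time with
    [example_pow_step]. *)
Lemma ideal_pow_example n : ideal_pow example_ideal n = example_pow n.
Proof.
elim: n => [|n IHn].
  apply/seteqP; split=> // f _; split=> b; rewrite ?muln0 sub0n;
  by exists f`_b; rewrite mulr1.
rewrite /ideal_pow iterS -/(ideal_pow example_ideal n) IHn; apply/seteqP; split.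
  apply: ideal_mul_sub; first exact: ideal_example_pow.
  move=> u v /example_ideal_sub[ux uz] [vx vz]; rewrite -add1n; split=> //.
    by rewrite mulnDr; exact: weight_ideal_mul.
  exact: weight_ideal_mul.
move=> f /example_pow_step[h [q [s [hM qM sM ->]]]].
have gen u : u \in example_gens -> example_ideal u.
  exact: (@sub_ideal_gen {poly C} [set` example_gens]).
have IM_ideal : ideal (ideal_mul example_ideal (example_pow n)) :=
  @ideal_ideal_gen _ _.
do 2?apply: (idealD IM_ideal).
all: rewrite mulrC; apply: mem_ideal_mul => //; apply: gen.
all: by rewrite !inE eqxx ?orbT.
Qed.

(** * Colon ideals and the associated primes P = (x, y) and Q = (y, z) *)

Let P : set {poly C} := weight_ideal x 1.
Let Q : set {poly C} := weight_ideal z 1.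

Lemma colon_weight_ideal p n f : prime_element p ->
  ~ weight_ideal p n f -> colon (weight_ideal p n) f `<=` weight_ideal p 1.
Proof.
move=> p_prime fW g gf; apply: contrapT => gW; apply: fW.
by apply: (weight_ideal_primary p_prime gW); rewrite mulrC.
Qed.

Lemma not_weight_ideal_z_x : ~ Q x%:P.
Proof. by rewrite /Q weight_ideal1E coefC; exact: not_divides_zx. Qed.

Lemma not_weight_ideal_x_z : ~ P z%:P.
Proof. by rewrite /P weight_ideal1E coefC; exact: not_divides_xz. Qed.

(** The witness lies in (y, z)^(n+1) and misses (x, y)^(2n+2) by exactly one factor, which an
    element of [P] supplies. *)
Lemma colon_example_x n : colon (example_pow n.+1) (y ^+ (2 * n).+1) = P.
Proof.
have yx : ~ weight_ideal x (2 * n.+1) (y ^+ (2 * n).+1).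
  move=> /(_ (2 * n).+1); rewrite coefXn eqxx (_ : _ - _ = 1)%N; last by lia.
  by have [_ + _] := x_prime; exact.
apply/seteqP; split=> [g [gx _]|g gP]; first exact: colon_weight_ideal gx.
split; last first.
  apply: (idealM _ (@ideal_weight_ideal C _ _)).
  apply: (@weight_ideal_leq _ _ n.+1 (2 * n).+1); first by lia.
  exact/weight_ideal_exp/weight_ideal_X.
rewrite (_ : 2 * n.+1 = 1 + (2 * n).+1)%N; last by lia.
exact/weight_ideal_mul/weight_ideal_exp/weight_ideal_X.
Qed.

(** The witness has total degree 2n + 2 in [x] and [y], so it lies in (x, y)^(2n+2), but it is one
    factor [y] short of (y, z)^(n+1). *)
Lemma colon_example_z n : colon (example_pow n.+1) ((x ^+ n.+2)%:P * y ^+ n) = Q.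
Proof.
have fz : ~ weight_ideal z n.+1 ((x ^+ n.+2)%:P * y ^+ n).
  move=> /(_ n); rewrite coefMXn ltnn subnn coefC subSnn expr1 /=.
  by move/(divides_prime_exp z_prime)/not_divides_zx.
apply/seteqP; split=> [g [_ gz]|g gQ]; first exact: colon_weight_ideal gz.
split.
  apply: (idealM _ (@ideal_weight_ideal C _ _)).
  rewrite (_ : 2 * n.+1 = n.+2 + n)%N; last by lia.
  apply: weight_ideal_mul; last exact/weight_ideal_exp/weight_ideal_X.
  by rewrite rmorphXn; exact/weight_ideal_exp/weight_ideal_C.
rewrite mulrCA; apply: (idealM _ (@ideal_weight_ideal C _ _)).
by rewrite -add1n; exact/weight_ideal_mul/weight_ideal_exp/weight_ideal_X.
Qed.

Lemma Ass_example_pow n : Ass (example_pow n.+1) = [set P; Q].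
Proof.
apply/seteqP; split=> [p [p_prime [f pE]]|p [|] ->]; last 2 first.
- split; first exact: prime_weight_ideal.
  by exists (y ^+ (2 * n).+1); rewrite colon_example_x.
- split; first exact: prime_weight_ideal.
  by exists ((x ^+ n.+2)%:P * y ^+ n); rewrite colon_example_z.
have [p1 pM] := prime_idealE p_prime.
have W (q : C) m := @ideal_weight_ideal C q m.
(* If [f] lies in both components the colon is the unit ideal; if in exactly one, the other
   component determines its prime. *)
have [fx|fx] := pselect (weight_ideal x (2 * n.+1) f);
  have [fz|fz] := pselect (weight_ideal z n.+1 f).
- by case: p1; rewrite pE /colon /= mul1r.
- right; apply/seteqP; split=> g; first by rewrite pE => -[_]; exact: colon_weight_ideal.
  move=> gQ; apply: (prime_ideal_exp (n := n.+1) p_prime); rewrite pE; split.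
    exact: idealM (W x (2 * n.+1)%N) fx.
  by rewrite mulrC; apply: (idealM _ (W z n.+1)); exact: weight_ideal_exp.
- left; apply/seteqP; split=> g; first by rewrite pE => -[+ _]; exact: colon_weight_ideal.
  move=> gP; apply: (prime_ideal_exp (n := (2 * n.+1)%N) p_prime); rewrite pE; split.
    by rewrite mulrC; apply: (idealM _ (W x (2 * n.+1)%N)); exact: weight_ideal_exp.
  exact: idealM (W z n.+1) fz.
have pP : p `<=` P by rewrite pE => g [+ _]; exact: colon_weight_ideal.
have pQ : p `<=` Q by rewrite pE => g [_]; exact: colon_weight_ideal.
(* If [f] lies in neither, [p] is contained in both primes. This product lies in the power of the
   ideal, so [p] contains [x] or [z], while [x] is not in [Q] and [z] is not in [P]. *)
have : p ((x%:P) ^+ (2 * n.+1) * (z%:P) ^+ n.+1).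
  rewrite pE; split; rewrite mulrC.
    apply: (idealM _ (W x (2 * n.+1)%N)); rewrite mulrC.
    apply: (idealM _ (W x (2 * n.+1)%N)).
    exact/weight_ideal_exp/weight_ideal_C.
  apply: (idealM _ (W z n.+1)); apply: (idealM _ (W z n.+1)).
  exact/weight_ideal_exp/weight_ideal_C.
move/pM => [] /(prime_ideal_exp p_prime).
  by move/pQ/not_weight_ideal_z_x.
by move/pP/not_weight_ideal_x_z.
Qed.

Lemma maximal_in_x : maximal_in [set P; Q] P.
Proof.
split; first by left.
move=> _ [->//|->] PQ; case: not_weight_ideal_z_x; apply: PQ.
exact: weight_ideal_C.
Qed.

Lemma maximal_in_z : maximal_in [set P; Q] Q.
Proof.
split; first by right.
move=> _ [->|->//] QP; case: not_weight_ideal_x_z; apply: QP.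
exact: weight_ideal_C.
Qed.

(** * The v-numbers at the two primes *)

Variable t : nat.

Lemma xdegree_monomial i j : xdegree t (t * i) ((x ^+ i)%:P * y ^+ j).
Proof.
apply/xdegreeP => b a ta; rewrite coefMXn; case: ltnP => _; first by rewrite coef0.
rewrite coefC; case: eqP => _; last by rewrite coef0.
by rewrite coefXn; case: eqP => // ai; case: ta; rewrite ai.
Qed.

Lemma vnumber_example_x n : vnumber (xdegree t) P (example_pow n.+1) = 0%N.
Proof.
apply: vnumberE => //; exists (y ^+ (2 * n).+1); last by rewrite colon_example_x.
by have := @xdegree_monomial 0 (2 * n).+1; rewrite muln0 expr0 polyC1 mul1r.
Qed.

Lemma vnumber_example_z n : vnumber (xdegree t) Q (example_pow n.+1) = (t * n.+2)%N.
Proof.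
apply: vnumberE => [|w [f fG QE]].
  exists ((x ^+ n.+2)%:P * y ^+ n); last by rewrite colon_example_z.
  exact: xdegree_monomial.
have Q_prime : prime_ideal Q by exact: prime_weight_ideal.
have W (q : C) m := @ideal_weight_ideal C q m.
(* Otherwise x^(2n+2) multiplies [f] into the intersection, which would put [x] in [Q]. *)
have fz : ~ weight_ideal z n.+1 f.
  move=> fz; apply: not_weight_ideal_z_x.
  apply: (prime_ideal_exp (n := (2 * n.+1)%N) Q_prime); rewrite QE; split.
    rewrite mulrC; apply: (idealM _ (W x (2 * n.+1)%N)).
    exact/weight_ideal_exp/weight_ideal_C.
  exact: idealM (W z n.+1) fz.
(* Otherwise the colon, which is [Q], would be contained in [P], yet it contains [z]. *)
have fx : weight_ideal x (2 * n.+1) f.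
  apply: contrapT => fx; apply: not_weight_ideal_x_z.
  apply: (colon_weight_ideal x_prime fx).
  have : Q z%:P by exact: weight_ideal_C.
  by rewrite QE => -[].
have [b fb] : exists b, ~ divides (z ^+ (n.+1 - b)) f`_b by exact/existsNP.
have bn : (b <= n)%N.
  rewrite leqNgt; apply/negP => nb; apply: fb; rewrite (eqP (nb : (n.+1 - b == 0)%N)).
  by exists f`_b; rewrite mulr1.
have fb0 : f`_b != 0 by apply/eqP => fb0; apply: fb; rewrite fb0; exact: divides0.
(* The leading monomial of this coefficient has [x]-degree [a], at least 2n + 2 - b because
   x^(2n+2-b) divides it, hence at least n + 2; homogeneity gives [w = t * a]. *)
have := fb0; rewrite -lead_coef_eq0 lead_coefE; set a := _.-1 => fba.
rewrite -(fG _ _ fba) leq_mul2l; apply/orP; right; rewrite leqNgt.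
apply: contra fba => an; have [q ->] := fx b; rewrite coefMXn.
by rewrite (_ : (a < _)%N) //; lia.
Qed.

(** * Limits of the slopes *)

Section Slopes.
Variable K : realType.

Lemma cvg_vslope_x :
  vslope K (xdegree t) P (ideal_pow example_ideal) @ \oo --> (0 : K).
Proof.
rewrite (_ : vslope _ _ _ _ = fun=> 0); first exact: cvg_cst.
(* At index 0 the quotient by 0 is 0 by convention. *)
apply/funext => -[|n]; first by rewrite /vslope invr0 mulr0.
by rewrite /vslope ideal_pow_example vnumber_example_x mul0r.
Qed.

Lemma cvg_vslope_z :
  vslope K (xdegree t) Q (ideal_pow example_ideal) @ \oo --> (t%:R : K).
Proof.
rewrite -cvg_shiftS.
(* After the shift the slope is t (n + 2) / (n + 1) = t + t / (n + 1). *)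
rewrite (_ : [sequence _]_n = (fun n => t%:R + t%:R * harmonic n)); last first.
  apply/funext => n /=; rewrite /vslope ideal_pow_example vnumber_example_z /harmonic /=.
  by rewrite -(addn1 n.+1) mulnDr muln1 natrD mulrDl natrM mulfK ?pnatr_eq0.
have : t%:R + t%:R * @harmonic K n @[n --> \oo] --> t%:R + t%:R * (0 : K).
  by apply: cvgD; [exact: cvg_cst|apply: cvgM; [exact: cvg_cst|exact: cvg_harmonic]].
by rewrite mulr0 addr0.
Qed.

End Slopes.

End Example.

(** * Both assertions, from the powers of one ideal over the rationals *)

Theorem corollary1p7 (K : realType) (t : nat) (ht : (0 < t)%N) :
  (exists (R : idomainType) (G F : nat -> set R),
     [/\ noetherian R,
         grading G,
         noetherian_filtration F,
         forall n, homogeneous_ideal G (F n)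
       & (\forall n \near \oo, Ass (F n) = Ass (F n.+1)) /\
         exists P Q : set R,
           [/\ \forall n \near \oo, maximal_in (Ass (F n)) P,
               \forall n \near \oo, maximal_in (Ass (F n)) Q,
               cvgn (vslope K G P F),
               cvgn (vslope K G Q F)
             & limn (vslope K G Q F) - limn (vslope K G P F) = t%:R]])
  /\
  (exists (R : idomainType) (G : nat -> set R) (I : set R),
     [/\ noetherian R,
         grading G,
         ideal I /\ homogeneous_ideal G I
       & exists (A : set (set R)) (P Q : set R),
           [/\ stable_Ass I A,
               maximal_in A P /\ maximal_in A Q,
               cvgn (vslope K G P (ideal_pow I)),
               cvgn (vslope K G Q (ideal_pow I))
             & limn (vslope K G P (ideal_pow I)) !=
               limn (vslope K G Q (ideal_pow I))]]).

Proof.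
pose A : idomainType := {poly rat}.
pose R : idomainType := {poly {poly A}}.
pose I : set R := @example_ideal rat.
pose P : set R := weight_ideal ('X : {poly A}) 1.
pose Q : set R := weight_ideal (('X : A)%:P : {poly A}) 1.
have AssI n : Ass (ideal_pow I n.+1) = [set P; Q].
  by rewrite (ideal_pow_example rat) Ass_example_pow.
have maxP := @maximal_in_x rat; have maxQ := @maximal_in_z rat.
have limP := @cvg_vslope_x rat t K; have limQ := @cvg_vslope_z rat t K.
have noethR : noetherian R by do 3!apply: noetherian_poly; exact: noetherian_field.
have R_grading : grading (xdegree (A := A) t) by exact: grading_xdegree.
have I_hom : homogeneous_ideal (xdegree (A := A) t) I.
  apply: homogeneous_ideal_gen => u /=; rewrite !inE => /or3P[] /eqP->.
  - by exists (t * 0)%N; have := @xdegree_monomial rat t 0 2; rewrite expr0 mul1r.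
  - by exists (t * 1)%N; have := @xdegree_monomial rat t 1 1; rewrite !expr1.
  (* The generator x^2 z involves [z], so [xdegree_monomial] does not cover it and its coefficients
     are inspected directly. *)
  - exists (t * 2)%N; apply/xdegreeP => b a ta.
    rewrite coefC; case: eqP => _; last by rewrite coef0.
    by rewrite mulrC coefCM coefXn; case: eqP ta => [->|]; rewrite ?mulr0.
split.
  exists R, (xdegree t), (ideal_pow I); split=> //.
  - split; first exact: filtration_ideal_pow.
    by exists [seq a%:P * 'X | a <- @example_gens rat]; exact: rees_ideal_pow.
  - by move=> n; exact: homogeneous_ideal_pow.
  (* The description of the associated primes holds for positive exponents, hence the shift by
     one. *)
  split; first by apply: near_succ => n; rewrite !AssI.
  exists P, Q; split.
  - by apply: near_succ => n; rewrite AssI.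
  - by apply: near_succ => n; rewrite AssI.
  - exact: cvgP limP.
  - exact: cvgP limQ.
  - by rewrite (cvg_lim _ limP) // (cvg_lim _ limQ) // subr0.
exists R, (xdegree t), I; split=> //; first by split=> //; exact: ideal_ideal_gen.
exists [set P; Q], P, Q; split=> //.
- by apply: near_succ => n; rewrite AssI.
- exact: cvgP limP.
- exact: cvgP limQ.
- by rewrite (cvg_lim _ limP) // (cvg_lim _ limQ) // eq_sym pnatr_eq0 -lt0n.
Qed.
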